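(* Let $k\ge2$, let $m$ be a positive integer, and let $\vec b=(b_0,b_1,\dots)$ and $\vec c=(c_0,c_1,\dots)$ be infinite sequences of integers. Suppose there exists a positive integer $u$ such that at least one of the following holds: (1) each of $b_u,b_{u+1},\dots,b_{u+k-1}$ is divisible by $m$; or (2) each of $c_{u-1},c_u,\dots,c_{u+k-2}$ is divisible by $m$. Then the sequence $\{\widehat{C}^{\vec b,\vec c}_{k,n}\bmod m\}_{n\ge0}$ is eventually periodic.
   Context: A $k$-dimensional balanced ballot path of length $kn$ is a sequence $P=(\vec s_1,\dots,\vec s_{kn})$ of standard unit vectors of $\mathbb{R}^k$ in which each $\vec e_i$ occurs exactly $n$ times and every intermediate point $\vec v_i=\sum_{j=1}^i\vec s_j$ ($0\le i\le kn$), $\vec x=(x_1,\dots,x_k)$, satisfies $x_1\ge\cdots\ge x_k$. The semisymmetric height of $\vec x\in\mathbb{Z}^k_{\ge0}$ is $g_k(\vec x)=\sum_{i=1}^k(k+1-2i)x_i$. A step $\vec e_i$ is a semisymmetric up-step if $i\le\lfloor k/2\rfloor$; all other steps (down-steps $\vec e_j$ with $j\ge k-\lfloor k/2\rfloor+1$, and for odd $k$ the neutral step $\vec e_{\lfloor k/2\rfloor+1}$) are non-up-steps. The semisymmetric weight of $P$ is $sswt_{\vec b,\vec c}(P)=\prod b_{u_i}\cdot\prod c_{u'_j}$, where the first product runs over the up-steps of $P$ with $u_i$ the semisymmetric height of the starting point of the $i$-th up-step, and the second runs over the non-up-steps with $u'_j$ the semisymmetric height of the resulting point of the $j$-th non-up-step.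 The $k$-dimensional semisymmetric weighted Catalan number is $\widehat{C}^{\vec b,\vec c}_{k,n}=\sum_P sswt_{\vec b,\vec c}(P)$, summed over all $k$-dimensional balanced ballot paths $P$ of length $kn$. *)

(* Defs.v *)
From HB Require Import structures.
From mathcomp Require Import all_boot all_order all_algebra zify.

Set Implicit Arguments.
Unset Strict Implicit.
Unset Printing Implicit Defensive.

Import Order.TTheory GRing.Theory Num.Theory.
Local Open Scope ring_scope.

(* Coordinates and steps are indexed from 0: [i : 'I_k] stands for the
   1-based index [i.+1], and a path is recorded as the sequence of the indices
   of its unit vectors. *)

Definition point (k : nat) (P : seq 'I_k) (t : nat) : 'rV[nat]_k :=
  \sum_(i <- take t P) delta_mx ord0 i.

Definition weakly_decreasing (k : nat) (x : 'rV[nat]_k) : bool :=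
  [forall i : 'I_k, forall j : 'I_k, (i <= j)%N ==> (x ord0 j <= x ord0 i)%N].

Definition balanced_ballot_path (k n : nat) (P : (k * n).-tuple 'I_k) : bool :=
  [forall i : 'I_k, count_mem i P == n]
  && [forall t : 'I_(k * n).+1, weakly_decreasing (point P t)].

Definition ssheight (k : nat) (x : 'rV[nat]_k) : int :=
  \sum_(i < k) (k%:Z + 1 - 2%:Z * i.+1%:Z) * (x ord0 i)%:Z.

Lemma ssheight_ge0 (k : nat) (x : 'rV[nat]_k) :
  weakly_decreasing x -> 0 <= ssheight x.
Proof.
move=> /forallP dx.
have {}dx (i j : 'I_k) : (i <= j)%N -> (x ord0 j <= x ord0 i)%N.
  by move=> ij; have /forallP/(_ j)/implyP := dx i; apply.
rewrite -(pmulrn_lge0 _ (isT : 0 < 2)%N) mulr2n.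
rewrite {2}/ssheight (reindex_inj rev_ord_inj) /= -big_split /=.
apply: sumr_ge0 => i _.
rewrite subnSK // -subzn ?(ltnW (ltn_ord i)) //.
have -> : k%:Z + 1 - 2%:Z * (k%:Z - i%:Z) = - (k%:Z + 1 - 2%:Z * i.+1%:Z).
  by rewrite -addn1 PoszD; lia.
rewrite mulNr -mulrBr.
have [le_i|lt_i] := leqP i (rev_ord i).
  rewrite mulr_ge0 ?subr_ge0 ?lez_nat ?dx //.
  by move: le_i (ltn_ord i) => /=; lia.
rewrite mulr_le0 ?subr_le0 ?lez_nat ?dx //; last exact: ltnW.
by move: lt_i (ltn_ord i) => /=; lia.
Qed.

(* Weights are only read at points of ballot paths, where the height is
   nonnegative by [ssheight_ge0], so the absolute value is just the cast of the
   height to an index in [nat]. *)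
Definition ssindex (k : nat) (x : 'rV[nat]_k) : nat := `|ssheight x|%N.

Definition up_step (k : nat) (i : 'I_k) : bool := (i < k %/ 2)%N.

Definition sswt (k n : nat) (b c : nat -> int) (P : (k * n).-tuple 'I_k) : int :=
  (\prod_(t < k * n | up_step (tnth P t)) b (ssindex (point P t)))
  * (\prod_(t < k * n | ~~ up_step (tnth P t)) c (ssindex (point P t.+1))).

Definition ssCatalan (k : nat) (b c : nat -> int) (n : nat) : int :=
  \sum_(P : (k * n).-tuple 'I_k | balanced_ballot_path P) sswt b c P.

Definition eventually_periodic (T : Type) (a : nat -> T) : Prop :=
  exists N p : nat,
    (0 < p)%N /\ forall n : nat, (N <= n)%N -> a (n + p)%N = a n.

(* Main.v *)
Require Import Defs.
From HB Require Import structures.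
From mathcomp Require Import all_boot all_order all_algebra.
From mathcomp Require Import zify.

(** Each step changes the height by at most [k - 1].  Hence a path that leaves
    the strip of heights at most [u + k - 1] uses an up-step starting in the
    window of (1) when it first leaves, and a down-step ending in the window of
    (2) when it last returns; either way its weight vanishes modulo [m].  In the
    strip, the ballot points form finitely many classes modulo translation by
    [(1, ..., 1)], and heights are invariant under this translation.  The
    Catalan number modulo [m] is therefore a coordinate of the [kn]-th iterate
    of a transfer operator on a finite set of vectors over [Z/m], and iterates
    of a self-map of a finite set are eventually periodic. *)

Set Implicit Arguments.
Unset Strict Implicit.
Unset Printing Implicit Defensive.

Import Order.TTheory GRing.Theory Num.Theory.
Local Open Scope ring_scope.

(** * Periodicity of iterates, residues and sums over tuples *)

Lemma iter_eventually_periodic (T : finType) (f : T -> T) (x : T) :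
  eventually_periodic (fun n => iter n f x).
Proof.
(* The iterate of index [order f x] equals an earlier one, of index [i]; their distance is a period
   from [i] on. *)
have /trajectP[i lt_i E] := looping_order f x.
exists i, (order f x - i)%N; split=> [|n le_in]; first by rewrite subn_gt0.
have -> : (n + (order f x - i) = (n - i) + order f x)%N by lia.
by rewrite iterD E -iterD subnK.
Qed.

Lemma eventually_periodic_mul (T : Type) (a : nat -> T) (q : nat) : (0 < q)%N ->
  eventually_periodic a -> eventually_periodic (fun n => a (q * n)%N).
Proof.
move=> q_gt0 [N [p [p_gt0 per]]]; exists N, p; split=> // n le_n.
have perM r t : (N <= t)%N -> a (t + r * p)%N = a t.
  move=> le_t; elim: r => [|r IH]; first by rewrite addn0.
  by rewrite mulSnr addnA per ?IH // (leq_trans le_t) ?leq_addr.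
by rewrite mulnDr perM // (leq_trans le_n) // leq_pmull.
Qed.

(** Passes from integer residues to the finite ring ['Z_m]. The bound on [m] matters: ['Z_1] has two
    elements. *)
Lemma modz_Zp (m : nat) (z : int) : (1 < m)%N ->
  (z %% m%:Z)%Z = (z%:~R : 'Z_m)%:Z.
Proof.
move=> m_gt1; have m_neq0 : m%:Z != 0 by lia.
rewrite {2}(divz_eq z m%:Z) intrD intrM -[m%:Z%:~R]/(m%:R) pchar_Zp // mulr0 add0r.
have := modz_ge0 z m_neq0; have := ltz_pmod z (_ : 0 < m%:Z).
case: (z %% m%:Z)%Z => // r /(_ _) lt_rm _.
rewrite -[(Posz r)%:~R]/(r%:R) val_Zp_nat // modn_small //.
by apply: lt_rm; lia.
Qed.

Lemma big_tuple_recl (R : nmodType) (T : finType) (n : nat)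
    (p : pred (seq T)) (F : seq T -> R) :
  \sum_(P : n.+1.-tuple T | p P) F P =
  \sum_(i : T) \sum_(P : n.-tuple T | p (i :: P)) F (i :: P).
Proof.
rewrite pair_big_dep /=.
rewrite (reindex (fun q : T * n.-tuple T => cons_tuple q.1 q.2)) //=.
exists (fun P : n.+1.-tuple T => (thead P, behead_tuple P)) => [[i P] _|P _] /=.
  by congr pair; apply: val_inj.
by case/tupleP: P => i P; apply: val_inj.
Qed.

(** * Heights *)

Lemma ssheightD k (x y : 'rV[nat]_k) :
  ssheight (x + y) = ssheight x + ssheight y.
Proof.
rewrite /ssheight -big_split; apply: eq_bigr => i _ /=.
by rewrite mxE PoszD mulrDr.
Qed.

Lemma ssheight_delta k (i : 'I_k) :
  ssheight (delta_mx ord0 i) = k%:Z + 1 - 2%:Z * i.+1%:Z.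
Proof.
rewrite /ssheight (bigD1 i) //= big1 => [|j /negbTE ji].
  by rewrite mxE !eqxx mulr1 addr0.
by rewrite mxE ji andbF mulr0.
Qed.

(** Mirror coordinates carry opposite coefficients. On a weakly decreasing row both factors of each
    term have the same sign, so every term is nonnegative. *)
Lemma ssheight_pairing k (x : 'rV[nat]_k) :
  ssheight x *+ 2 = \sum_(i < k) (k%:Z + 1 - 2%:Z * i.+1%:Z)
                      * ((x ord0 i)%:Z - (x ord0 (rev_ord i))%:Z).
Proof.
rewrite mulr2n {2}/ssheight (reindex_inj rev_ord_inj) /= -big_split /=.
apply: eq_bigr => i _; rewrite [RHS]mulrBr -[X in _ = _ + X]mulNr.
by congr (_ + _ * _); have := ltn_ord i; lia.
Qed.

Lemma ssheight_const k (a : nat) : ssheight (const_mx a : 'rV[nat]_k) = 0.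
Proof.
have : ssheight (const_mx a : 'rV[nat]_k) *+ 2 = 0.
  by rewrite ssheight_pairing big1 // => i _; rewrite !mxE subrr mulr0.
by move/eqP; rewrite mulrn_eq0 => /eqP.
Qed.

Lemma ssindex_const k (x : 'rV[nat]_k) (a : nat) :
  ssindex (x + const_mx a) = ssindex x.
Proof. by rewrite /ssindex ssheightD ssheight_const addr0. Qed.

Lemma weakly_decreasingP k (x : 'rV[nat]_k) :
  reflect (forall i j : 'I_k, (i <= j)%N -> (x ord0 j <= x ord0 i)%N)
          (weakly_decreasing x).
Proof.
apply: (iffP forallP) => [dx i j ij|dx i].
  by have /forallP/(_ j)/implyP := dx i; apply.
by apply/forallP=> j; apply/implyP=> /dx.
Qed.

Lemma weakly_decreasing_const k (x : 'rV[nat]_k) (a : nat) :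
  weakly_decreasing (x + const_mx a) = weakly_decreasing x.
Proof.
apply: eq_forallb => i; apply: eq_forallb => j.
by rewrite !mxE leq_add2r.
Qed.

Lemma ssindexE k (x : 'rV[nat]_k) :
  weakly_decreasing x -> (ssindex x)%:Z = ssheight x.
Proof. by move=> /ssheight_ge0 h; rewrite /ssindex gez0_abs. Qed.

(** All terms of [ssheight_pairing] are nonnegative, and in dimension at least 2 the first one is a
    positive multiple of the difference of the first and last coordinates. Bounded height thus
    leaves finitely many rows modulo translation. *)
Lemma spread_le k (x : 'rV[nat]_k.+1) (i : 'I_k.+1) :
  weakly_decreasing x -> (x ord0 i - x ord0 ord_max <= 2 * ssindex x)%N.
Proof.
move=> dx; have h2 := ssheight_pairing x; rewrite -ssindexE // in h2.
move/weakly_decreasingP: dx => dx.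
have x0i := dx ord0 i (leq0n _); have xim := dx i ord_max (leq_ord i).
case: k => [|k] in x i dx h2 x0i xim *; first by rewrite !ord1 subnn.
rewrite (bigD1 ord0) //= in h2.
set r := \sum_(j < _ | _) _ in h2.
have r_ge0 : 0 <= r.
  apply: sumr_ge0 => j _.
  have [le_j|lt_j] := leqP j (rev_ord j).
    rewrite mulr_ge0 ?subr_ge0 ?lez_nat ?dx //.
    by move: le_j (ltn_ord j) => /=; lia.
  rewrite mulr_le0 ?subr_le0 ?lez_nat ?dx //; last exact: ltnW.
  by move: lt_j (ltn_ord j) => /=; lia.
have E : rev_ord ord0 = ord_max :> 'I_k.+2 by apply: val_inj => /=; lia.
rewrite E in h2.
have : (x ord0 ord0)%:Z - (x ord0 ord_max)%:Z
   <= (k.+2%:Z + 1 - 2%:Z * 1) * ((x ord0 ord0)%:Z - (x ord0 ord_max)%:Z).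
  by rewrite ler_peMl ?subr_ge0 ?lez_nat ?(leq_trans xim) //; lia.
by move: h2; rewrite mulr2n; lia.
Qed.

(** * Points of a path *)

Lemma point0 k (P : seq 'I_k) : point P 0 = 0.
Proof. by rewrite /point take0 big_nil. Qed.

Lemma point_cons k (i : 'I_k) (P : seq 'I_k) t :
  point (i :: P) t.+1 = delta_mx ord0 i + point P t.
Proof. by rewrite /point /= big_cons. Qed.

Lemma pointS k n (P : n.-tuple 'I_k) (t : 'I_n) :
  point P t.+1 = point P t + delta_mx ord0 (tnth P t).
Proof.
have x0 := tnth P t.
by rewrite /point (take_nth x0) ?size_tuple // big_rcons /= (tnth_nth x0).
Qed.

Lemma point_size k (P : seq 'I_k) (i : 'I_k) :
  point P (size P) ord0 i = count_mem i P.
Proof.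
rewrite /point take_size.
elim: P => [|j P IH]; first by rewrite big_nil mxE.
by rewrite big_cons !mxE IH /= eq_sym natn.
Qed.

Lemma sum_count_mem_size (T : finType) (s : seq T) :
  (\sum_(i : T) count_mem i s = size s)%N.
Proof.
elim: s => [|x s IH] /=; first by rewrite big1.
rewrite big_split /= IH (bigD1 x) //= eqxx big1 // => i.
by rewrite eq_sym => /negbTE ->.
Qed.

Definition is_const_row k (x : 'rV[nat]_k) : bool :=
  [forall i, forall j, x ord0 i == x ord0 j].

Lemma is_const_rowP k (x : 'rV[nat]_k.+1) :
  reflect (x = const_mx (x ord0 ord_max)) (is_const_row x).
Proof.
apply: (iffP forallP) => [cx|-> i].
  by apply/rowP=> i; rewrite mxE; have /forallP/(_ ord_max)/eqP := cx i.
by apply/forallP => j; rewrite !mxE.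
Qed.

Lemma is_const_row_const k (x : 'rV[nat]_k) a :
  is_const_row (x + const_mx a) = is_const_row x.
Proof.
apply: eq_forallb => i; apply: eq_forallb => j.
by rewrite !mxE eqn_add2r.
Qed.

(** Equal counts must all be [n], since they add up to the length. Balance thus becomes a
    translation-invariant condition on the endpoint. *)
Lemma balanced_const k n (P : (k.+1 * n).-tuple 'I_k.+1) :
  [forall i : 'I_k.+1, count_mem i P == n]
    = is_const_row (point P (k.+1 * n)%N).
Proof.
have pE j : point P (k.+1 * n)%N ord0 j = count_mem j P.
  by rewrite -point_size size_tuple.
apply/forallP/forallP => [cP i|cP i].
  by apply/forallP=> j; rewrite !pE (eqP (cP i)) eq_sym.
have {}cP j : count_mem j P = count_mem i P.
  by have /forallP/(_ i)/eqP := cP j; rewrite !pE.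
have := sum_count_mem_size P.
rewrite (eq_bigr (fun=> count_mem i P)) // sum_nat_const card_ord size_tuple.
by move/eqP; rewrite eqn_mul2l.
Qed.

Lemma ballot_decreasing k n (P : (k * n).-tuple 'I_k) t :
  balanced_ballot_path P -> (t <= k * n)%N -> weakly_decreasing (point P t).
Proof. by case/andP=> _ /forallP dP le_t; apply: (dP (Ordinal (le_t : t < _.+1)%N)). Qed.

Lemma ballot_end_height k n (P : (k.+1 * n).-tuple 'I_k.+1) :
  balanced_ballot_path P -> ssindex (point P (k.+1 * n)%N) = 0%N.
Proof.
by case/andP; rewrite balanced_const => /is_const_rowP -> _; rewrite /ssindex ssheight_const.
Qed.

Lemma ssheight_step k n (P : n.-tuple 'I_k) (t : 'I_n) :
  ssheight (point P t.+1)
    = ssheight (point P t) + (k%:Z + 1 - 2%:Z * (tnth P t).+1%:Z).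
Proof. by rewrite pointS ssheightD ssheight_delta. Qed.

(** * Paths leaving the strip *)

Lemma sswt_dvd_high_up k n (d : int) (b c : nat -> int) u
    (P : (k * n).-tuple 'I_k) t :
  (forall i, (u <= i <= u + k - 1)%N -> (d %| b i)%Z) ->
  balanced_ballot_path P ->
  (t <= k * n)%N -> (u + k - 1 < ssindex (point P t))%N ->
  (d %| sswt b c P)%Z.
Proof.
move=> db bP le_t high_t.
have ex : exists t, (t <= k * n)%N && (u + k - 1 < ssindex (point P t))%N.
  by exists t; rewrite le_t.
(* The first time above the strip is some [s.+1], as the path starts at height 0. Step [s] gains at
   most [k - 1], so it starts in the window of [b]; only up-steps gain height. *)
case: (ex_minnP ex) => [[|s]] /andP[le_s high_s] min_s.
  by move: high_s; rewrite point0 -[0]/(const_mx 0) /ssindex ssheight_const.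
pose s' := Ordinal le_s.
have low_s : (ssindex (point P s) <= u + k - 1)%N.
  rewrite leqNgt; apply/negP => h; have := min_s s.
  by rewrite h (ltnW le_s) ltnn => /(_ isT).
have hs := ssheight_step P s'.
rewrite /= -!ssindexE ?(ballot_decreasing bP) // in hs; last exact: ltnW.
have up_s : up_step (tnth P s') by rewrite /up_step; lia.
rewrite /sswt dvdz_mulr // (bigD1 s') //= dvdz_mulr // db //.
by move: hs high_s low_s; have := ltn_ord (tnth P s'); lia.
Qed.

Lemma sswt_dvd_high_down k n (d : int) (b c : nat -> int) u
    (P : (k.+1 * n).-tuple 'I_k.+1) t : (0 < k)%N ->
  (forall i, (u - 1 <= i <= u + k.+1 - 2)%N -> (d %| c i)%Z) ->
  balanced_ballot_path P ->
  (t <= k.+1 * n)%N -> (u + k.+1 - 1 < ssindex (point P t))%N ->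
  (d %| sswt b c P)%Z.
Proof.
move=> k_gt0 dc bP le_t high_t.
(* The threshold is the top of the window of [c]: the step after the last time above it loses
   height, by at most [k], and so lands in that window. *)
have ex : exists t, (t <= k.+1 * n)%N && (u + k.+1 - 2 < ssindex (point P t))%N.
  by exists t; rewrite le_t; lia.
have ub s : (s <= k.+1 * n)%N && (u + k.+1 - 2 < ssindex (point P s))%N ->
  (s <= k.+1 * n)%N by case/andP.
case: (ex_maxnP ex ub) => s /andP[le_s high_s] max_s.
(* A next step exists because the path ends at height 0. *)
have lt_s : (s < k.+1 * n)%N.
  rewrite ltn_neqAle le_s andbT; apply/eqP => E.
  by move: high_s; rewrite E ballot_end_height.
pose s' := Ordinal lt_s.
have low_s : (ssindex (point P s.+1) <= u + k.+1 - 2)%N.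
  rewrite leqNgt; apply/negP => h; have := max_s s.+1.
  by rewrite h lt_s ltnn => /(_ isT).
have hs := ssheight_step P s'.
rewrite /= -!ssindexE ?(ballot_decreasing bP) // in hs.
have up_s : ~~ up_step (tnth P s') by rewrite /up_step; lia.
rewrite /sswt dvdz_mull // (bigD1 s') //= dvdz_mulr // dc //.
by move: hs high_s low_s; have := ltn_ord (tnth P s'); lia.
Qed.

(** * Transfer operator *)

Section Transfer.

Variables (k H : nat).

Definition in_strip (x : 'rV[nat]_k.+1) : bool :=
  weakly_decreasing x && (ssindex x <= H)%N.

Lemma in_strip_const x a : in_strip (x + const_mx a) = in_strip x.
Proof. by rewrite /in_strip weakly_decreasing_const ssindex_const. Qed.

Lemma in_strip0 : in_strip 0.
Proof.
rewrite /in_strip -[0]/(const_mx 0) /ssindex ssheight_const leq0n andbT.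
by apply/weakly_decreasingP => i j _; rewrite !mxE.
Qed.

(** The start [x] is not tested, so that the condition splits off the first step cleanly; lemmas
    that need [x] in the strip assume it. *)
Fixpoint strip_path (x : 'rV[nat]_k.+1) (s : seq 'I_k.+1) : bool :=
  if s is i :: s' then
    in_strip (x + delta_mx ord0 i) && strip_path (x + delta_mx ord0 i) s'
  else is_const_row x.

Lemma strip_pathP x (s : seq 'I_k.+1) : in_strip x ->
  reflect ((forall t, (t <= size s)%N -> in_strip (x + point s t)) /\
           is_const_row (x + point s (size s)))
          (strip_path x s).
Proof.
elim: s x => [|i s IH] x sx /=.
  rewrite !point0 addr0; apply: (iffP idP) => [cx|[]//]; split=> // t.
  by rewrite leqn0 => /eqP ->; rewrite point0 addr0.
rewrite point_cons addrA.
apply: (iffP andP) => [[sy /(IH _ sy)[ss cs]]|[ss cs]].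
  split=> // -[|t] lt_t; first by rewrite point0 addr0.
  by rewrite point_cons addrA ss.
have sy : in_strip (x + delta_mx ord0 i).
  by have := ss 1%N isT; rewrite point_cons point0 addr0.
split=> //; apply/(IH _ sy); split=> // t le_t.
by have := ss t.+1 le_t; rewrite point_cons addrA.
Qed.

Lemma strip_path0 n (P : (k.+1 * n).-tuple 'I_k.+1) :
  strip_path 0 P = balanced_ballot_path P &&
    [forall t : 'I_(k.+1 * n).+1, (ssindex (point P t) <= H)%N].
Proof.
apply/(strip_pathP _ in_strip0)/andP; rewrite size_tuple add0r.
  move=> [ss cs]; split; last first.
    by apply/forallP=> t; have /andP[] := ss t (leq_ord t); rewrite add0r.
  rewrite /balanced_ballot_path balanced_const cs /=.
  by apply/forallP=> t; have /andP[] := ss t (leq_ord t); rewrite add0r.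
move=> [bP /forallP hP]; split=> [t le_t|]; last first.
  by rewrite -balanced_const; case/andP: bP.
rewrite add0r /in_strip (ballot_decreasing bP) //=.
exact: (hP (Ordinal (le_t : t < _.+1)%N)).
Qed.

Variables (R : comNzRingType).

Definition step_weight (b c : nat -> R) (x : 'rV[nat]_k.+1) (i : 'I_k.+1) : R :=
  if up_step i then b (ssindex x) else c (ssindex (x + delta_mx ord0 i)).

Fixpoint path_weight (b c : nat -> R) (x : 'rV[nat]_k.+1) (s : seq 'I_k.+1) : R :=
  if s is i :: s' then
    step_weight b c x i * path_weight b c (x + delta_mx ord0 i) s'
  else 1.

Lemma path_weight_prod b c x N (P : N.-tuple 'I_k.+1) :
  path_weight b c x P =
  \prod_(t < N) step_weight b c (x + point P t) (tnth P t).
Proof.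
elim: N P x => [|N IH] P x; first by rewrite tuple0 big_ord0.
case/tupleP: P => i P /=.
rewrite big_ord_recl point0 addr0 tnth0 IH; congr (_ * _).
by apply: eq_bigr => t _; rewrite tnthS lift0 point_cons addrA.
Qed.

Lemma path_weight_sswt (b c : nat -> int) n (P : (k.+1 * n).-tuple 'I_k.+1) :
  path_weight (fun j => (b j)%:~R) (fun j => (c j)%:~R) 0 P = (sswt b c P)%:~R.
Proof.
rewrite path_weight_prod /sswt intrM !rmorph_prod /=.
rewrite (bigID (fun t => up_step (tnth P t))) /=; congr (_ * _).
  by apply: eq_bigr => t u; rewrite /step_weight u add0r.
by apply: eq_bigr => t /negbTE u; rewrite /step_weight u add0r pointS.
Qed.

(** The start is arbitrary so that removing the first step gives a recursion on [t]. *)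
Definition strip_sum b c (t : nat) (x : 'rV[nat]_k.+1) : R :=
  \sum_(P : t.-tuple 'I_k.+1 | strip_path x P) path_weight b c x P.

Lemma strip_sum0 b c x : strip_sum b c 0 x = (is_const_row x)%:R.
Proof.
rewrite /strip_sum big_mkcond (big_pred1 [tuple]) /=.
  by case: (is_const_row x).
by move=> P; rewrite [P]tuple0; apply/esym/eqP.
Qed.

Lemma strip_sumS b c t x : strip_sum b c t.+1 x =
  \sum_(i < k.+1 | in_strip (x + delta_mx ord0 i))
     step_weight b c x i * strip_sum b c t (x + delta_mx ord0 i).
Proof.
rewrite /strip_sum big_tuple_recl [RHS]big_mkcond /=; apply: eq_bigr => i _.
by case: in_strip => /=; rewrite ?big_pred0_eq // mulr_sumr.
Qed.

(* A class of strip points modulo translation is represented by the differences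
   with the last coordinate; these are at most [2 * H] by [spread_le]. *)
Definition state := {ffun 'I_k.+1 -> 'I_(2 * H).+1}.

(** Outside the strip [inord] may return a default value; [transfer] only applies [state_of] to
    points of the strip. *)
Definition state_of (x : 'rV[nat]_k.+1) : state :=
  [ffun i => inord (x ord0 i - x ord0 ord_max)%N].

Definition row_of (s : state) : 'rV[nat]_k.+1 := \row_i (s i : nat).

Lemma row_of_state x : in_strip x ->
  x = row_of (state_of x) + const_mx (x ord0 ord_max).
Proof.
move=> /andP[dx hx]; apply/rowP => i; rewrite !mxE ffunE inordK.
  by rewrite -[RHS]/(_ + _)%N subnK // ((weakly_decreasingP _ dx) i ord_max) ?leq_ord.
by rewrite ltnS (leq_trans (spread_le i dx)) // leq_mul2l.
Qed.

Lemma state_of_const x a : state_of (x + const_mx a) = state_of x.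
Proof. by apply/ffunP=> i; rewrite !ffunE !mxE subnDr. Qed.

Definition transfer b c (g : {ffun state -> R}) : {ffun state -> R} :=
  [ffun s => \sum_(i < k.+1 | in_strip (row_of s + delta_mx ord0 i))
     step_weight b c (row_of s) i * g (state_of (row_of s + delta_mx ord0 i))].

Definition const_state : {ffun state -> R} :=
  [ffun s => (is_const_row (row_of s))%:R].

Lemma strip_sum_iter b c t x : in_strip x ->
  strip_sum b c t x = iter t (transfer b c) const_state (state_of x).
Proof.
elim: t x => [|t IH] x sx.
  by rewrite strip_sum0 ffunE {1}(row_of_state sx) is_const_row_const.
rewrite strip_sumS iterS ffunE.
(* The representative [y] differs from [x] by a constant row, which affects neither strip
   membership, nor states, nor step weights. *)
set y := row_of (state_of x).
have Ey i : x + delta_mx ord0 i = y + delta_mx ord0 i + const_mx (x ord0 ord_max).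
  by rewrite {1}(row_of_state sx) addrAC.
apply: eq_big => [i|i si]; first by rewrite Ey in_strip_const.
rewrite IH // Ey state_of_const; congr (_ * _).
by rewrite /step_weight Ey ssindex_const {1}(row_of_state sx) ssindex_const.
Qed.

End Transfer.

(** * Reduction modulo m and conclusion *)

Lemma ssCatalan_Zp k m H (b c : nat -> int) n : (1 < m)%N ->
  (forall P : (k.+1 * n).-tuple 'I_k.+1, balanced_ballot_path P ->
     forall t, (t <= k.+1 * n)%N -> (H < ssindex (point P t))%N ->
     (m%:Z %| sswt b c P)%Z) ->
  (ssCatalan k.+1 b c n)%:~R =
  strip_sum H (fun j => (b j)%:~R : 'Z_m) (fun j => (c j)%:~R) (k.+1 * n) (0 : 'rV_k.+1).
Proof.
move=> m_gt1 dvd_high.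
rewrite /ssCatalan rmorph_sum /= /strip_sum.
under [RHS]eq_bigl do rewrite strip_path0.
rewrite [RHS]big_mkcondr; apply: eq_bigr => P bP; rewrite path_weight_sswt.
(* A ballot path absent from the strip sum rises above [H], so its weight is zero in ['Z_m]. *)
case: ifPn => // /forallPn[t]; rewrite -ltnNge => high_t.
have /dvdzP[q ->] := dvd_high P bP t (leq_ord t) high_t.
by rewrite intrM -[m%:Z%:~R]/(m%:R) pchar_Zp // mulr0.
Qed.

Theorem theorem3p3 (k m : nat) (b c : nat -> int)
  (hk : (2 <= k)%N) (hm : (0 < m)%N)
  (hu : exists u : nat, (0 < u)%N /\
     ((forall i : nat, (u <= i <= u + k - 1)%N -> (m%:Z %| b i)%Z) \/
      (forall i : nat, (u - 1 <= i <= u + k - 2)%N -> (m%:Z %| c i)%Z))) :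
  eventually_periodic (fun n : nat => (ssCatalan k b c n %% m%:Z)%Z).
Proof.
case: k hk hu => [//|k] k_gt0 [u [_ hu]].
have [m_gt1|m_le1] := ltnP 1 m; last first.
  have -> : m = 1%N by lia.
  by exists 0%N, 1%N; split=> // n _; rewrite !modz1.
pose H := (u + k.+1 - 1)%N.
pose bm j : 'Z_m := (b j)%:~R; pose cm j : 'Z_m := (c j)%:~R.
have E n : (ssCatalan k.+1 b c n)%:~R
    = iter (k.+1 * n) (transfer bm cm) (const_state k H 'Z_m) (state_of H 0).
  rewrite -strip_sum_iter ?in_strip0 //.
  apply: ssCatalan_Zp => // P bP t le_t high_t.
  case: hu => [hb|hc]; first exact: sswt_dvd_high_up hb bP le_t high_t.
  exact: sswt_dvd_high_down hc bP le_t high_t.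
(* Over ['Z_m] the functions on states form a finite type; the orbit is sampled at multiples of the
   dimension [k.+1]. *)
have [N [p [p_gt0 per]]] := eventually_periodic_mul (ltn0Sn k)
  (iter_eventually_periodic (transfer bm cm) (const_state k H 'Z_m)).
by exists N, p; split=> // n le_n; rewrite !modz_Zp // !E per.
Qed.
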